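(* Let $\mathcal{H}$ be a separable infinite-dimensional complex Hilbert space, let $\mathcal{J}$ be a proper two-sided ideal of $B(\mathcal{H})$, and let $\tau : \mathcal{J} \to \mathbb{C}$ be a spectral trace. Then for all $A, B \in B(\mathcal{H})$ such that $AB \in \mathcal{J}$ and $BA \in \mathcal{J}$, one has $$\tau(AB) = \tau(BA).$$
   Context: $B(\mathcal{H})$ denotes the algebra of bounded linear operators on $\mathcal{H}$. Ideals are not assumed to be closed in norm; every proper two-sided ideal of $B(\mathcal{H})$ consists of compact operators. A trace on $\mathcal{J}$ is a linear functional $\tau : \mathcal{J} \to \mathbb{C}$ that is unitarily invariant: $\tau(UAU^* ) = \tau(A)$ for every $A \in \mathcal{J}$ and every unitary $U \in B(\mathcal{H})$. No positivity or continuity is assumed. For a compact operator $A$, $\lambda(A) = (\lambda_n(A))_{n \ge 1}$ denotes an eigenvalue sequence of $A$: the nonzero eigenvalues of $A$ listed in order of nonincreasing modulus, each repeated according to its algebraic multiplicity. If there are only finitely many nonzero eigenvalues (counted with multiplicity), the sequence is continued by zeros; if there are infinitely many, zero is omitted from the sequence. The algebraic multiplicity of a nonzero eigenvalue $\lambda$ of $A$ is the (finite) dimension of its generalized eigenspace $\{v \in \mathcal{H} : (\lambda I - A)^n v = 0 \text{ for some } n \in \mathbb{N}\}$. The order of eigenvalues of equal modulus is not prescribed, so $\lambda(A)$ may be nonunique. For a bounded complex sequence $x = (x_n)$, $\operatorname{diag}(x)$ denotes the diagonal operator with diagonal entries $x_n$ with respect to a fixed orthonormal basis of $\mathcal{H}$;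 the choice of basis and of admissible ordering of $\lambda(A)$ changes $\operatorname{diag}(\lambda(A))$ only by unitary equivalence. A trace $\tau$ on $\mathcal{J}$ is called spectral if for every $A \in \mathcal{J}$ one has $\operatorname{diag}(\lambda(A)) \in \mathcal{J}$ and $\tau(A) = \tau(\operatorname{diag}(\lambda(A)))$. *)

(* Defs.v *)
From HB Require Import structures.
From mathcomp Require Import all_boot all_order all_algebra.
From mathcomp Require Import sesquilinear complex.
From mathcomp Require Import all_classical all_reals all_analysis.
Set Implicit Arguments.
Unset Strict Implicit.
Unset Printing Implicit Defensive.
Import Order.TTheory GRing.Theory Num.Theory.
Import numFieldNormedType.Exports.
Local Open Scope classical_set_scope.
Local Open Scope complex_scope.
Local Open Scope ring_scope.

Section Space.
Context (R : realType) (H : completeNormedModType R[i]).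
Implicit Types (A B T : H -> H) (V : set H) (d : nat).

(* [H] is a Hilbert space when its norm comes from [dot], which is linear in
   its first argument and conjugate-linear in the second one. *)
Definition dot_induces_norm (dot : {dot H for Num.conj}) : Prop :=
  forall u, dot u u = `|u| ^+ 2.

Definition separable_space : Prop :=
  exists2 D : set H, countable D & dense D.

Definition has_dim V d : Prop :=
  exists b : 'I_d -> H,
    (forall c : 'I_d -> R[i], \sum_i c i *: b i = 0 -> forall i, c i = 0) /\
    (forall v, V v <-> exists c : 'I_d -> R[i], v = \sum_i c i *: b i).

Definition infinite_dimensional : Prop := forall d, ~ has_dim [set: H] d.

Definition bounded_op : set (H -> H) :=
  [set T | linear T /\ exists M : R, forall x, `|T x| <= M%:C * `|x|].

(* Closure under scalars follows by composing with multiples of the identity. *)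
Record two_sided_ideal (J : set (H -> H)) : Prop := TwoSidedIdeal {
  ideal_bounded : J `<=` bounded_op;
  ideal_zero : J (fun _ => 0);
  ideal_add : forall A B, J A -> J B -> J (A + B);
  ideal_compl : forall A T, bounded_op T -> J A -> J (T \o A);
  ideal_compr : forall A T, bounded_op T -> J A -> J (A \o T) }.

Definition proper_two_sided_ideal (J : set (H -> H)) : Prop :=
  two_sided_ideal J /\ J <> bounded_op.

Definition generalized_eigenspace T (mu : R[i]) : set H :=
  [set v | exists n : nat, iter n (fun w => mu *: w - T w) v = 0].

(* The rule for zeros is a consequence: since moduli are nonincreasing, a zero
   entry is followed by zeros only, so it occurs exactly when the nonzero
   eigenvalues, counted with multiplicity, are finitely many. *)
Definition eigenvalue_sequence T (x : nat -> R[i]) : Prop :=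
  (forall n, `|x n.+1| <= `|x n|) /\
  (forall mu, mu != 0 -> exists d,
     has_dim (generalized_eigenspace T mu) d /\ ([set n | x n = mu] #= `I_d)%card).

Section Dot.
Variable dot : {dot H for Num.conj}.

Definition orthonormal_basis (e : nat -> H) : Prop :=
  (forall i j, dot (e i) (e j) = (i == j)%:R) /\
  (forall u, (fun n => \sum_(k < n) dot u (e k) *: e k) @ \oo --> u).

Definition diag_op (e : nat -> H) (x : nat -> R[i]) : H -> H :=
  fun u => limn (fun n => \sum_(k < n) (x k * dot u (e k)) *: e k).

Definition is_adjoint T Ts : Prop := forall u v, dot (T u) v = dot u (Ts v).

Definition unitary_with_adjoint U Us : Prop :=
  [/\ bounded_op U, bounded_op Us, is_adjoint U Us,
      U \o Us = id & Us \o U = id].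

(* A functional on [J] is represented by a total function: its values outside
   [J] are never used. *)
Definition is_trace (J : set (H -> H)) (tau : (H -> H) -> R[i]) : Prop :=
  (forall (a : R[i]) A B, J A -> J B ->
     tau (a *: A + B) = a * tau A + tau B) /\
  (forall A U Us, J A -> unitary_with_adjoint U Us ->
     tau (U \o A \o Us) = tau A).

(* Quantifies over all admissible orderings of the eigenvalues.  That an
   eigenvalue sequence exists for each member of a proper ideal is a theorem of
   Calkin and Riesz, not part of this definition. *)
Definition spectral_trace (e : nat -> H) (J : set (H -> H))
    (tau : (H -> H) -> R[i]) : Prop :=
  is_trace J tau /\
  forall A, J A -> forall x, eigenvalue_sequence A x ->
    J (diag_op e x) /\ tau A = tau (diag_op e x).

End Dot.
End Space.

Arguments separable_space {R} H.
Arguments infinite_dimensional {R} H.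
Arguments bounded_op {R H}.

(* Main.v *)
Require Import Defs.
From HB Require Import structures.
From mathcomp Require Import all_boot all_order all_algebra.
From mathcomp Require Import sesquilinear complex.
From mathcomp Require Import all_classical all_reals all_analysis.
From mathcomp Require Import finmap.
Import numFieldNormedType.Exports.
Local Open Scope complex_scope.
Local Open Scope ring_scope.
Set Implicit Arguments.
Unset Strict Implicit.
Unset Printing Implicit Defensive.
Import Order.TTheory GRing.Theory Num.Theory.
Local Open Scope classical_set_scope.

(** The operators [A \o B] and [B \o A] have the same nonzero eigenvalues with
    the same algebraic multiplicities: [B] maps the generalized eigenspace of
    [A \o B] at a nonzero [mu] bijectively onto that of [B \o A]
    ([has_dim_generalized_eigenspace_comp]). Hence an eigenvalue sequence [x] of
    one is an eigenvalue sequence of the other, and a spectral trace takes on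
    both the value it takes on the diagonal operator of [x].

    It remains to see that a member [T] of a proper ideal has an eigenvalue
    sequence at all ([exists_eigenvalue_sequence]). Compactness of [T]
    enters in the following form: finite orthonormal systems on which [T] is
    triangular with diagonal entries of modulus at least [eps] (the towers below)
    cannot be prolonged for ever ([exists_maximal_tower]). A maximal tower is a
    finite list, and its span contains all generalized eigenvectors for every
    [mu] of modulus at least [eps], since otherwise the Gram-Schmidt process
    would prolong it ([generalized_eigenspace_expands]). This gives finite multiplicities and no
    accumulation of eigenvalues away from [0], so the eigenvalues can be listed
    by decreasing modulus ([multiplicity_sequence]).

    Towers stop for the following reason ([ideal_full_of_triangular]). Let [T] be
    triangular with diagonal bounded away from [0] on an orthonormal sequence
    [f]. As [f] tends weakly to [0], the off-diagonal entries of [T] along a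
    sparse subsequence are as small as desired. Compressing [T] to that
    subsequence, transporting it to the basis [e] and dividing by the diagonal
    gives an operator [1 + K] with [K] of norm at most [1/2], which belongs to
    the ideal and has a bounded left inverse by the Neumann series. Then the
    ideal contains the identity and is not proper. *)

(** * Inner products and orthonormal sequences *)

Section InnerProduct.
Context (R : realType) (H : completeNormedModType R[i]).
Context (dot : {dot H for Num.conj}).

Lemma dotC u v : dot u v = (dot v u)^*%R.
Proof. by rewrite hermC expr0 mul1r. Qed.

Lemma dotDl u v w : dot (u + v) w = dot u w + dot v w.
Proof. exact: (linearDl dot w). Qed.

Lemma dotZl a u w : dot (a *: u) w = a * dot u w.
Proof. exact: (linearZl_LR dot w). Qed.

Lemma dot0l w : dot 0 w = 0.
Proof. exact: (linear0l dot w). Qed.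

Lemma dotBl u v w : dot (u - v) w = dot u w - dot v w.
Proof. by rewrite -scaleN1r dotDl dotZl mulN1r. Qed.

Lemma dotZr a u w : dot w (a *: u) = a^*%R * dot w u.
Proof. by rewrite dotC dotZl rmorphM (dotC w u). Qed.

Lemma dotBr u v w : dot w (u - v) = dot w u - dot w v.
Proof. by rewrite dotC dotBl rmorphB (dotC w u) (dotC w v). Qed.

Lemma dot_suml (I : Type) (r : seq I) (F : I -> H) w :
  dot (\sum_(i <- r) F i) w = \sum_(i <- r) dot (F i) w.
Proof.
elim: r => [|i r IH]; first by rewrite !big_nil dot0l.
by rewrite !big_cons dotDl IH.
Qed.

Lemma dot_sumr (I : Type) (r : seq I) (F : I -> H) w :
  dot w (\sum_(i <- r) F i) = \sum_(i <- r) dot w (F i).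
Proof.
by rewrite dotC dot_suml rmorph_sum; apply: eq_bigr => i _; rewrite (dotC w).
Qed.

Definition orthonormal_seq (g : nat -> H) : Prop :=
  forall i j, dot (g i) (g j) = (i == j)%:R.

Hypothesis hdot : dot_induces_norm dot.

Lemma norm_orthonormal g k : orthonormal_seq g -> `|g k| = 1.
Proof.
move=> og; have := hdot (g k); rewrite og eqxx => /esym/eqP.
by rewrite sqrf_eq1 => /orP[/eqP//|/eqP h]; have := normr_ge0 (g k);
  rewrite h oppr_ge0 ler10.
Qed.

Lemma sqr_norm_sum_orthonormal g (a : nat -> R[i]) m n : orthonormal_seq g ->
  `|\sum_(m <= k < n) a k *: g k| ^+ 2 = \sum_(m <= k < n) `|a k| ^+ 2.
Proof.
move=> og; set s := \sum_(_ <= _ < _) _.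
rewrite -(hdot s) {1}/s dot_suml.
rewrite big_seq [RHS]big_seq; apply: eq_bigr => i im.
rewrite /s dot_sumr (bigD1_seq i) ?iota_uniq //=.
rewrite dotZl dotZr og eqxx mulr1 -normCK big1 ?addr0// => j ji.
by rewrite dotZr dotZl og eq_sym (negbTE ji) !mulr0.
Qed.

Lemma bessel g u n : orthonormal_seq g ->
  \sum_(k < n) `|dot u (g k)| ^+ 2 <= `|u| ^+ 2.
Proof.
move=> og; rewrite -(big_mkord xpredT (fun k => `|dot u (g k)| ^+ 2)).
set p := \sum_(0 <= k < n) dot u (g k) *: g k.
set s := (X in X <= _).
have pu : dot u p = s.
  rewrite /p dot_sumr; apply: eq_bigr => k _.
  by rewrite dotZr mulrC -normCK.
have sr : s^*%R = s.
  by rewrite rmorph_sum; apply: eq_bigr => k _; rewrite rmorphXn /= conj_normC.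
have pp : dot p p = s by rewrite hdot sqr_norm_sum_orthonormal.
have : 0 <= dot (u - p) (u - p) by rewrite hdot exprn_ge0.
rewrite dotBl !dotBr (dotC p u) pu sr pp subrr subr0 hdot.
by rewrite subr_ge0.
Qed.

Lemma norm_dot_orthonormal g u k : orthonormal_seq g -> `|dot u (g k)| <= `|u|.
Proof.
move=> og; rewrite -(@ler_pXn2r _ 2)// ?nnegrE//.
apply: le_trans (bessel u k.+1 og).
by rewrite big_ord_recr /= lerDr sumr_ge0// => i _; rewrite exprn_ge0.
Qed.

End InnerProduct.

(** * Convergence and bounded operators *)

Section Convergence.
Context (R : realType) (H : completeNormedModType R[i]).
Implicit Types (T : H -> H) (u v : H).

Lemma norm_ReC (V : normedZmodType R[i]) (x : V) :
  (complex.Re `|x|)%:C = `|x|.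
Proof. exact: RRe_real (normr_real x). Qed.

Lemma gt0_ReC (x : R[i]) : 0 < x -> exists2 e : R, 0 < e & x = e%:C.
Proof.
move=> x0; exists (complex.Re x).
  by move: x0; rewrite ltcE => /andP[_].
by rewrite RRe_real// ger0_real// ltW.
Qed.

Lemma cvg_of_cauchy_bound (u : nat -> H) :
  (forall eps : R, 0 < eps ->
    exists N, forall m n, (N <= m <= n)%N -> `|u n - u m| <= eps%:C) ->
  cvgn u.
Proof.
move=> uC; apply/cauchy_cvgP/cauchy_exP => eps /gt0_ReC[e e0 ->].
have /uC[N uN] : 0 < e / 2 by rewrite divr_gt0.
exists (u N), N => // n /= Nn; rewrite -ball_normE /= distrC.
apply: (@le_lt_trans _ _ (e / 2)%:C); first by apply: uN; rewrite leqnn.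
by rewrite ltcR ltr_pdivrMr// ltr_pMr// ltr1n.
Qed.

Lemma cvg_dist_le (u : nat -> H) (l : H) :
  u @ \oo --> l -> forall eps : R, 0 < eps ->
  exists N, forall n, (N <= n)%N -> `|l - u n| <= eps%:C.
Proof.
move=> ul eps e0; have e0' : 0 < eps%:C :> R[i] by rewrite ltcR.
by move: ul => /cvgrPdist_le/(_ _ e0')[N _ h]; exists N => n; exact: h.
Qed.

Lemma norm_lim_le (u : nat -> H) (l : H) (M : R[i]) :
  u @ \oo --> l -> (forall n, `|u n| <= M) -> `|l| <= M.
Proof.
move=> ul uM; have M0 : 0 <= M := le_trans (normr_ge0 _) (uM 0%N).
have [|lM] := real_leP (normr_real l) (ger0_real M0); first by [].
have /gt0_ReC[e e0 eE] : 0 < `|l| - M by rewrite subr_gt0.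
have /(cvg_dist_le ul)[N /(_ N (leqnn _)) h] : 0 < e / 2 by rewrite divr_gt0.
have : e%:C <= (e / 2)%:C :> R[i].
  rewrite -eE; apply: le_trans h; rewrite lerBlDr.
  rewrite -{1}(subrK (u N) l); apply: le_trans (ler_normD _ _) _.
  by rewrite lerD2l.
by rewrite lecR ler_pdivlMr// ger_pMr// lern1.
Qed.

Lemma bounded_op_add T u v : bounded_op T -> T (u + v) = T u + T v.
Proof. by move=> [lT _]; have := lT 1 u v; rewrite !scale1r. Qed.

Lemma bounded_op_zero T : bounded_op T -> T 0 = 0.
Proof.
by move=> bT; have := bounded_op_add 0 0 bT; rewrite addr0 -{1}[T 0]addr0 =>
  /addrI.
Qed.

Lemma bounded_op_scale T a u : bounded_op T -> T (a *: u) = a *: T u.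
Proof.
by move=> bT; have := bT.1 a u 0; rewrite !addr0 bounded_op_zero ?addr0.
Qed.

Lemma bounded_op_sub T u v : bounded_op T -> T (u - v) = T u - T v.
Proof.
by move=> bT; rewrite -scaleN1r bounded_op_add// bounded_op_scale// scaleN1r.
Qed.

Lemma bounded_op_sum T (I : Type) (r : seq I) (F : I -> H) : bounded_op T ->
  T (\sum_(i <- r) F i) = \sum_(i <- r) T (F i).
Proof.
move=> bT; elim: r => [|i r IH]; first by rewrite !big_nil bounded_op_zero.
by rewrite !big_cons bounded_op_add// IH.
Qed.

Lemma bounded_op_bound T : bounded_op T ->
  exists2 M : R, 0 < M & forall x, `|T x| <= M%:C * `|x|.
Proof.
move=> [_ [M TM]]; exists (`|M| + 1); first by rewrite ltr_wpDl.
move=> x; apply: le_trans (TM x) _; apply: ler_wpM2r => //.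
by rewrite lecR (le_trans (ler_norm M))// lerDl.
Qed.

Lemma bounded_op_cvg T (u : nat -> H) (l : H) :
  bounded_op T -> u @ \oo --> l -> T \o u @ \oo --> T l.
Proof.
move=> bT ul; have [M M0 TM] := bounded_op_bound bT.
apply/cvgrPdist_le => eps /gt0_ReC[e e0 ->].
have /(cvg_dist_le ul)[N uN] : 0 < e / M by rewrite divr_gt0.
exists N => // n /= Nn; rewrite -bounded_op_sub//.
apply: le_trans (TM _) _.
apply: (@le_trans _ _ (M%:C * (e / M)%:C)).
  by rewrite ler_pM2l ?ltcR//; exact: uN.
by rewrite -rmorphM /= mulrCA divff ?mulr1 // gt_eqF.
Qed.

Lemma bounded_op_id : bounded_op (@id H).
Proof. by split => [//|]; exists 1 => x; rewrite mul1r. Qed.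

Lemma bounded_op_comp T T' : bounded_op T -> bounded_op T' ->
  bounded_op (T \o T').
Proof.
move=> bT bT'; have [M M0 TM] := bounded_op_bound bT.
have [M' M'0 TM'] := bounded_op_bound bT'.
split=> [a x y /=|]; first by rewrite bT'.1 bT.1.
exists (M * M') => x /=; apply: le_trans (TM _) _.
by rewrite rmorphM /= -mulrA ler_pM2l ?ltcR.
Qed.

Lemma bounded_op_subf T T' : bounded_op T -> bounded_op T' ->
  bounded_op (fun x => T x - T' x).
Proof.
move=> bT bT'; have [M M0 TM] := bounded_op_bound bT.
have [M' M'0 TM'] := bounded_op_bound bT'.
split=> [a x y /=|]; first by rewrite bT'.1 bT.1 scalerBr opprD addrACA.
exists (M + M') => x; apply: le_trans (ler_normB _ _) _.
by rewrite rmorphD /= mulrDl lerD.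
Qed.

(** [N u] is the fixed point of the contraction [v |-> u - K v], obtained as the
    limit of its iterates from [0], which are the partial sums of the Neumann
    series. *)
Lemma neumann_left_inverse (K : H -> H) : bounded_op K ->
  (forall x, `|K x| <= 2^-1 * `|x|) ->
  exists2 N : H -> H, bounded_op N & forall x, N (x + K x) = x.
Proof.
move=> bK K2.
pose v u n := iter n (fun w => u - K w) 0.
have step u n : `|v u n.+1 - v u n| <= (2^-1) ^+ n * `|u|.
  elim: n => [|n IH].
    by rewrite /v /= bounded_op_zero// !subr0 expr0 mul1r.
  rewrite /v /= -/(v u n.+1) -/(v u n) opprB addrC addrA subrK -bounded_op_sub//.
  by rewrite (le_trans (K2 _))// exprS -mulrA ler_pM2l ?invr_gt0// distrC.
have dist u m k : `|v u (m + k)%N - v u m| <= 2 * (2^-1) ^+ m * `|u|.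
  suff : `|v u (m + k)%N - v u m| <=
      (2 * (2^-1) ^+ m - 2 * (2^-1) ^+ (m + k)) * `|u|.
    move/le_trans; apply; rewrite ler_wpM2r// gerBl mulr_ge0// exprn_ge0//.
  elim: k => [|k IH]; first by rewrite addn0 !subrr normr0 mul0r.
  rewrite addnS -(subrK (v u (m + k)%N) (v u (m + k).+1)) -addrA.
  apply: le_trans (ler_normD _ _) _.
  apply: le_trans (lerD (step _ _) IH) _.
  rewrite -mulrDl ler_wpM2r// exprS (mulrA 2) divff ?pnatr_eq0// mul1r.
  by rewrite addrCA lerD2l mulr2n mulrDl mul1r opprD addrA subrr add0r.
have cvgv u : cvgn (v u).
  apply: cvg_of_cauchy_bound => eps e0.
  have : (fun m => 2 * (2^-1 : R) ^+ m * complex.Re `|u|) @ \oo --> (0 : R).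
    rewrite -[X in _ --> X](mul0r (complex.Re `|u|)).
    apply: cvgM; last exact: cvg_cst.
    rewrite -[X in _ --> X](mulr0 (2 : R)); apply: cvgM; first exact: cvg_cst.
    by apply: cvg_expr; rewrite ger0_norm ?invr_ge0// invf_lt1// ltr1n.
  move=> /cvgrPdist_le /(_ _ e0)[N _ hN]; exists N => m n /andP[Nm mn].
  rewrite -(subnKC mn); apply: le_trans (dist _ _ _) _.
  have := hN _ Nm; rewrite /= sub0r normrN => h.
  have {h} := le_trans (ler_norm _) h; rewrite -lecR.
  have -> : (2 * 2^-1 ^+ m * complex.Re `|u|)%:C = 2 * (2^-1) ^+ m * `|u|.
    by rewrite 2!rmorphM rmorphXn fmorphV rmorph_nat /= norm_ReC.
  by [].

pose N u := limn (v u).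
have vS u : v u n.+1 @[n --> \oo] --> N u.
  by have := cvgv u; rewrite -(cvg_shiftS (v u)).
have fixN u : N u = u - K (N u).
  apply: (@cvg_unique _ (@norm_hausdorff _ _) (v u n.+1 @[n --> \oo])) => //.
    exact: vS.
  apply: cvgB; first exact: cvg_cst.
  exact: (bounded_op_cvg bK (cvgv u)).
have inj x y : x + K x = y + K y -> x = y.
  move=> xy; apply/eqP; rewrite -subr_eq0 -normr_eq0.
  have : `|x - y| <= 2^-1 * `|x - y|.
    suff {1}-> : x - y = - K (x - y) by rewrite normrN.
    rewrite bounded_op_sub//; apply/eqP; move/eqP: xy.
    by rewrite -subr_eq0 opprD addrACA addr_eq0.
  rewrite {1}(splitr `|x - y|) mulrC gerDl pmulr_rle0 ?invr_gt0// => d0.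
  by rewrite eq_le d0 normr_ge0.
exists N.
  split.
  - move=> a x y; apply: inj; rewrite bK.1.
    have e z : N z + K (N z) = z by rewrite {1}fixN subrK.
    by rewrite e -addrA (addrCA (N y)) e addrA -scalerDr e.
  - exists 2 => x.
    have : `|N x| <= `|x| + 2^-1 * `|N x|.
      by rewrite {1}fixN (le_trans (ler_normB _ _))// lerD2l.
    rewrite {1}(splitr `|N x|) [_ / 2]mulrC lerD2r ler_pdivrMl//.
    by rewrite rmorph_nat.
by move=> x; apply: inj; rewrite {1}fixN subrK.
Qed.

End Convergence.

(** * Operators between orthonormal systems *)

Section OrthonormalOperators.
Context (R : realType) (H : completeNormedModType R[i]).
Context (dot : {dot H for Num.conj}).
Hypothesis hdot : dot_induces_norm dot.

Lemma cvg_series_orthonormal g (a : nat -> R[i]) (B : R[i]) :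
  orthonormal_seq dot g -> (forall n, \sum_(k < n) `|a k| ^+ 2 <= B) ->
  cvgn (fun n => \sum_(k < n) a k *: g k).
Proof.
move=> og aB.
have [b bE] : exists b : R, B = b%:C.
  have B0 : 0 <= B by have := aB 0%N; rewrite big_ord0.
  by exists (complex.Re B); rewrite RRe_real// ger0_real.
pose s n : R := \sum_(0 <= k < n) complex.Re `|a k| ^+ 2.
have sE m n : (\sum_(m <= k < n) complex.Re `|a k| ^+ 2)%:C =
    \sum_(m <= k < n) `|a k| ^+ 2.
  rewrite rmorph_sum; apply: eq_bigr => k _.
  by rewrite rmorphXn.
have ndec : nondecreasing_seq s.
  apply/nondecreasing_seqP => n; rewrite /s big_nat_recr //= lerDl.
  by rewrite sqr_ge0.
have sb n : s n <= b.
  by rewrite -lecR -bE sE big_mkord.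
have scvg : cvgn s.
  by apply: nondecreasing_is_cvgn => //; exists b => _ [n _ <-].
apply: cvg_of_cauchy_bound => eps e0.
have e20 : 0 < eps ^+ 2 by rewrite exprn_gt0.
move: (scvg) => /cvgrPdist_le/(_ _ e20)[N _ hN].
exists N => m n /andP[Nm mn].
rewrite -(@ler_pXn2r _ 2) ?nnegrE ?normr_ge0 ?ler0c ?(ltW e0)//.
rewrite -!(big_mkord xpredT (fun k => a k *: g k)) (big_cat_nat (leq0n m) mn)//=.
rewrite addrAC subrr add0r (sqr_norm_sum_orthonormal hdot)// -sE.
have -> : eps%:C ^+ 2 = (eps ^+ 2)%:C :> R[i] by rewrite rmorphXn.
rewrite lecR.
have -> : \sum_(m <= k < n) complex.Re `|a k| ^+ 2 = s n - s m.
  by rewrite /s (big_cat_nat (leq0n m) mn)//= addrAC subrr add0r.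
apply: (@le_trans _ _ (limn s - s m)).
  by rewrite lerD2r; apply: nondecreasing_cvgn_le.
by apply: le_trans (ler_norm _) _; apply: hN.
Qed.

(** Bessel's inequality makes the series converge and bounds the operator; it
    generalizes both isometries between orthonormal systems and diagonal
    operators. *)
Lemma orthonormal_transfer g h (c : nat -> R[i]) (C : R) :
  orthonormal_seq dot g -> orthonormal_seq dot h ->
  (forall k, `|c k| <= C%:C) ->
  exists2 W : H -> H, bounded_op W &
    forall u, (fun n => \sum_(k < n) (c k * dot u (g k)) *: h k) @ \oo --> W u.
Proof.
move=> og oh cC.
have C0 : 0 <= C%:C by apply: le_trans (cC 0%N).
have bnd u n : \sum_(k < n) `|c k * dot u (g k)| ^+ 2 <= (C%:C * `|u|) ^+ 2.
  apply: (@le_trans _ _ (\sum_(k < n) C%:C ^+ 2 * `|dot u (g k)| ^+ 2)).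
    apply: ler_sum => k _; rewrite normrM exprMn ler_wpM2r ?exprn_ge0//.
    by rewrite lerXn2r// nnegrE.
  by rewrite -mulr_sumr exprMn ler_wpM2l ?exprn_ge0// bessel.
pose s u n := \sum_(k < n) (c k * dot u (g k)) *: h k.
have scvg u : cvgn (s u).
  exact: (cvg_series_orthonormal (a := fun k => c k * dot u (g k)) oh (bnd u)).
exists (fun u => limn (s u)); last by move=> u; exact: scvg.
split=> [a u v|].
  apply: cvg_lim => //.
  have -> : s (a *: u + v) = (fun n => a *: s u n + s v n).
    apply/funext => n; rewrite /s scaler_sumr -big_split /=.
    apply: eq_bigr => k _.
    by rewrite dotDl dotZl mulrDr scalerDl scalerA mulrCA.
  by apply: cvgD; [apply: cvgZr; exact: scvg|exact: scvg].
exists C => u; apply: norm_lim_le (scvg u) _ => n.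
rewrite -(@ler_pXn2r _ 2) ?nnegrE ?normr_ge0 ?mulr_ge0//.
rewrite /s -(big_mkord xpredT (fun k => (c k * dot u (g k)) *: h k)).
by rewrite (sqr_norm_sum_orthonormal hdot)// big_mkord.
Qed.

End OrthonormalOperators.

(** * Histories and dependent choice *)

Section History.
Context (X : Type).

Definition history (f : nat -> X) n := rev (mkseq f n).

Lemma historyS f n : history f n.+1 = f n :: history f n.
Proof. by rewrite /history mkseqS rev_rcons. Qed.

Lemma size_history f n : size (history f n) = n.
Proof. by rewrite size_rev size_mkseq. Qed.

(** Dependent choice: a relation that prolongs every finite history is followed
    by an infinite sequence. *)
Lemma history_choice (P : seq X -> X -> Prop) :
  (forall s, exists x, P s x) -> exists f, forall n, P (history f n) (f n).
Proof.
move=> /choice[next nextP].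
pose l := fix l n := if n is m.+1 then next (l m) :: l m else [::].
exists (fun n => next (l n)) => n.
suff -> : history (fun n => next (l n)) n = l n by exact: nextP.
by elim: n => [//|n IH]; rewrite historyS IH.
Qed.

End History.

Lemma mem_history (X : eqType) (f : nat -> X) m n :
  (m < n)%N -> f m \in history f n.
Proof. by move=> mn; rewrite mem_rev map_f// mem_iota. Qed.

Lemma sum_history (X : Type) (V : nmodType) (f : nat -> X) (F : X -> V) n :
  \sum_(x <- history f n) F x = \sum_(k < n) F (f k).
Proof.
elim: n => [|n IH]; first by rewrite big_ord0 /history big_nil.
by rewrite historyS big_cons IH big_ord_recr addrC.
Qed.

(** * Weak convergence of orthonormal sequences *)

Section WeakConvergence.
Context (R : realType) (H : completeNormedModType R[i]).
Context (dot : {dot H for Num.conj}).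
Hypothesis hdot : dot_induces_norm dot.

(** Bessel's inequality for the image of [f m] under the adjoint of [T]. *)
Lemma sum_sqr_dot_image (T : H -> H) (f : nat -> H) (M : R) m n :
  orthonormal_seq dot f -> (forall x, `|T x| <= M%:C * `|x|) -> bounded_op T ->
  \sum_(k < n) `|dot (T (f k)) (f m)| ^+ 2 <= M%:C ^+ 2.
Proof.
move=> of_ TM bT; set q := (X in X <= _).
have q0 : 0 <= q by apply: sumr_ge0 => k _; rewrite exprn_ge0.
have M0 : 0 <= M%:C :> R[i].
  by have := le_trans (normr_ge0 _) (TM (f 0%N));
    rewrite (norm_orthonormal hdot)// mulr1.
(* The vector at which the functional x |-> dot (T x) (f m) attains its norm
   on the span of f 0, ..., f (n-1). *)
pose x := \sum_(0 <= k < n) (dot (T (f k)) (f m))^*%R *: f k.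
have xx : `|x| ^+ 2 = q.
  rewrite (sqr_norm_sum_orthonormal hdot)// big_mkord.
  by apply: eq_bigr => k _; rewrite norm_conjC.
have dx : dot (T x) (f m) = q.
  rewrite /x bounded_op_sum// dot_suml big_mkord; apply: eq_bigr => k _.
  by rewrite bounded_op_scale// dotZl mulrC -normCK.
have qx : q <= M%:C * `|x|.
  rewrite -[leLHS]ger0_norm// -dx.
  exact: le_trans (norm_dot_orthonormal hdot _ _ of_) (TM _).
have [->|qn0] := eqVneq q 0; first by rewrite exprn_ge0.
have qp : 0 < q by rewrite lt_neqAle eq_sym qn0.
rewrite -(ler_pM2r qp) -[X in _ ^+ 2 * X]xx -exprMn -expr2.
by rewrite lerXn2r// nnegrE// mulr_ge0.
Qed.

(** An orthonormal sequence tends weakly to zero, and so does its image: by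
    [sum_sqr_dot_image] the entries in question are square-summable in [n]. *)
Lemma exists_small_dots (T : H -> H) (f : nat -> H) (s : seq nat) (d : R) n0 :
  orthonormal_seq dot f -> bounded_op T -> 0 < d ->
  exists2 n, (n0 <= n)%N & \sum_(m <- s) `|dot (T (f n)) (f m)| ^+ 2 <= d%:C.
Proof.
move=> of_ bT d0; have [M M0 TM] := bounded_op_bound bT.
pose a n := \sum_(m <- s) `|dot (T (f n)) (f m)| ^+ 2.
have aR n : a n \is Num.real.
  by apply: ger0_real; apply: sumr_ge0 => k _; rewrite exprn_ge0.
apply: contrapT => noex.
have dR : d%:C \is @Num.real R[i] by rewrite complex_real.
have ad n : (n0 <= n)%N -> d%:C <= a n.
  move=> nn0; have [and|/ltW//] := real_leP (aR n) dR.
  by exfalso; apply: noex; exists n.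
have bnd k : (d *+ k)%:C <= (M ^+ 2 *+ size s)%:C :> R[i].
  apply: (@le_trans _ _ (\sum_(n < n0 + k) a n)).
    rewrite big_split_ord /= -[leLHS]add0r lerD//.
      by apply: sumr_ge0 => n _; apply: sumr_ge0 => m _; rewrite exprn_ge0.
    rewrite raddfMn /= -[X in _ *+ X]card_ord -sumr_const.
    by apply: ler_sum => n _; apply: ad; rewrite leq_addr.
  rewrite exchange_big /= raddfMn /= -sum1_size -sumrMnr big_seq [leRHS]big_seq.
  apply: ler_sum => m _; rewrite rmorphXn mulr1n.
  exact: sum_sqr_dot_image.
have [k kM] : exists k, M ^+ 2 *+ size s < d *+ k.
  exists (Num.truncn (M ^+ 2 *+ size s / d)).+1.
  by rewrite -[X in _ < X]mulr_natr -ltr_pdivrMl// mulrC truncnS_gt.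
by have := bnd k; rewrite lecR leNgt kM.
Qed.

Lemma cvg_eventually_eq (u : nat -> H) (l l' : H) N :
  (forall n, (N <= n)%N -> u n = l) -> u @ \oo --> l' -> l' = l.
Proof.
move=> uN ul'; apply: (@cvg_unique _ (@norm_hausdorff _ _) (u @ \oo)) => //.
by apply: cvg_near_cst; exists N.
Qed.

End WeakConvergence.

(** * Ideals containing a triangular operator *)

Section TriangularOperators.
Context (R : realType) (H : completeNormedModType R[i]).
Context (dot : {dot H for Num.conj}).
Hypothesis hdot : dot_induces_norm dot.

(** The weights sum to [1/2]. *)
Lemma small_on_basis_norm_le (e : nat -> H) (K : H -> H) :
  orthonormal_basis dot e -> bounded_op K ->
  (forall k, `|K (e k)| <= 2^-1 ^+ k.+2) -> forall u, `|K u| <= 2^-1 * `|u|.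
Proof.
move=> [oe be] bK Ke u.
apply: norm_lim_le (bounded_op_cvg bK (be u)) _ => n /=.
rewrite bounded_op_sum//; apply: le_trans (ler_norm_sum _ _ _) _.
apply: (@le_trans _ _ (\sum_(k < n) 2^-1 ^+ k.+2 * `|u|)).
  apply: ler_sum => k _; rewrite bounded_op_scale// normrZ mulrC.
  by rewrite ler_pM//; exact: norm_dot_orthonormal.
rewrite -mulr_suml ler_wpM2r//.
suff -> : \sum_(k < n) 2^-1 ^+ k.+2 = 2^-1 - 2^-1 ^+ n.+1 :> R[i].
  by rewrite gerBl exprn_ge0.
elim: n => [|n IH]; first by rewrite big_ord0 expr1 subrr.
rewrite big_ord_recr /= IH -addrA; congr (_ + _).
by rewrite (splitr (2^-1 ^+ n.+1)) -exprSr opprD addrNK.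
Qed.

(** On a sparse subsequence [g] of [f] the matrix [dot (T (g k)) (g j)] is an
    invertible diagonal matrix times [1 + K] with [K] of norm at most [1/2], so
    the ideal contains an operator with a bounded left inverse. *)
Lemma ideal_full_of_triangular (e : nat -> H) (J : set (H -> H))
    (T : H -> H) (f : nat -> H) (eps : R) :
  orthonormal_basis dot e -> two_sided_ideal J -> J T ->
  orthonormal_seq dot f -> 0 < eps ->
  (forall n m, (n < m)%N -> dot (T (f n)) (f m) = 0) ->
  (forall n, eps%:C <= `|dot (T (f n)) (f n)|) ->
  J = bounded_op.
Proof.
move=> be idJ JT of_ eps0 Ttri Tdiag.
have oe := be.1; have bT := ideal_bounded idJ JT.
(* The admissible next indices [n] after the indices [s]. *)
pose small (s : seq nat) (n : nat) := (forall m, m \in s -> (m < n)%N) /\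
  \sum_(m <- s) `|dot (T (f n)) (f m)| ^+ 2
    <= ((eps * 2^-1 ^+ (size s).+2) ^+ 2)%:C.
have [nu nuP] : exists nu, forall n, small (history nu n) (nu n).
  apply: history_choice => s.
  have d0 : 0 < (eps * 2^-1 ^+ (size s).+2) ^+ 2.
    by rewrite exprn_gt0// mulr_gt0// exprn_gt0// invr_gt0.
  have [n sn hn] := exists_small_dots hdot s (\max_(m <- s) m).+1 of_ bT d0.
  exists n; split=> // m ms; apply: leq_trans sn.
  by rewrite ltnS; exact: (@leq_bigmax_seq _ s xpredT id m ms isT).
have nu_lt j k : (j < k)%N -> (nu j < nu k)%N.
  by move=> jk; apply: (nuP k).1; exact: mem_history.
have nu_eq j k : (nu j == nu k) = (j == k).
  have [->|] := eqVneq j k; first by rewrite eqxx.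
  by rewrite neq_ltn => /orP[/nu_lt|/nu_lt]; [move/ltn_eqF|move/gtn_eqF].
pose g k := f (nu k).
have og : orthonormal_seq dot g by move=> j k; rewrite /g of_ nu_eq.
pose c k := (dot (T (g k)) (g k))^-1.
have d_gt0 k : 0 < `|dot (T (g k)) (g k)|.
  by apply: lt_le_trans (Tdiag _); rewrite ltcR.
have cC k : `|c k| <= (eps^-1)%:C.
  rewrite /c normfV (fmorphV (real_complex R)).
  by rewrite lef_pV2 ?posrE ?d_gt0 ?ltcR//; exact: Tdiag.
have one (k : nat) : `|1 : R[i]| <= 1%:C by rewrite normr1.
(* [S] sends the basis [e] to [g]; [L] sends [g] back to [e], dividing by the
   diagonal of [T]. *)
have [S bS SP] := orthonormal_transfer hdot (c := fun=> 1) oe og one.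
have [L bL LP] := orthonormal_transfer hdot og oe cC.
have Se k : S (e k) = g k.
  apply: (cvg_eventually_eq (N := k.+1) _ (SP (e k))) => n kn.
  rewrite -(big_mkord xpredT (fun j => (1 * dot (e k) (e j)) *: g j)).
  rewrite (bigD1_seq k) ?iota_uniq ?mem_index_iota //= mul1r oe eqxx scale1r.
  rewrite big1 ?addr0// => j jk.
  by rewrite oe eq_sym (negbTE jk) mulr0 scale0r.
pose K u := L (T (S u)) - u.
have bX : bounded_op (L \o T \o S) :=
  bounded_op_comp (bounded_op_comp bL bT) bS.
have bK : bounded_op K by apply: (bounded_op_subf bX (bounded_op_id H)).
have Ke k : K (e k) = \sum_(0 <= j < k) (c j * dot (T (g k)) (g j)) *: e j.
  apply/eqP; rewrite /K Se subr_eq; apply/eqP.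
  apply: (cvg_eventually_eq (N := k.+1) _ (LP (T (g k)))) => n kn.
  rewrite -(big_mkord xpredT (fun j => (c j * dot (T (g k)) (g j)) *: e j)).
  rewrite (big_cat_nat (leq0n k.+1) kn) /= [X in _ + X]big_nat_cond.
  rewrite [X in _ + X]big1 ?addr0 => [|j /andP[/andP[kj _] _]].
    by rewrite big_nat_recr //= mulVf -?normr_gt0// scale1r.
  by rewrite Ttri ?mulr0 ?scale0r//; exact: nu_lt.
have Ksmall k : `|K (e k)| <= 2^-1 ^+ k.+2.
  rewrite Ke -(@ler_pXn2r _ 2) ?nnegrE ?exprn_ge0//.
  rewrite (sqr_norm_sum_orthonormal hdot)//.
  have := (nuP k).2; rewrite sum_history size_history => hk.
  apply: (@le_trans _ _ ((eps^-1)%:C ^+ 2 *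
      \sum_(j < k) `|dot (T (g k)) (g j)| ^+ 2)).
    rewrite mulr_sumr big_mkord; apply: ler_sum => j _.
    by rewrite normrM exprMn ler_wpM2r ?exprn_ge0// lerXn2r ?nnegrE// ler0c
      invr_ge0 ltW.
  apply: (@le_trans _ _ ((eps^-1)%:C ^+ 2 * ((eps * 2^-1 ^+ k.+2) ^+ 2)%:C)).
    by rewrite ler_wpM2l// exprn_ge0// ler0c invr_ge0 ltW.
  have -> : (eps^-1)%:C ^+ 2 * ((eps * 2^-1 ^+ k.+2) ^+ 2)%:C =
      ((eps^-1 * (eps * 2^-1 ^+ k.+2)) ^+ 2)%:C.
    rewrite [in RHS]exprMn (rmorphM (real_complex R) (eps^-1 ^+ 2)).
    by rewrite (rmorphXn (real_complex R) 2 eps^-1).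
  by rewrite mulKf ?gt_eqF// !rmorphXn fmorphV rmorph_nat.
have [N bN NP] := neumann_left_inverse bK
  (small_on_basis_norm_le be bK Ksmall).
have Jid : J id.
  have -> : id = N \o (L \o T \o S).
    by apply/funext => u /=; rewrite -[LHS]NP /K addrC subrK.
  exact (ideal_compl idJ bN (ideal_compr idJ bS (ideal_compl idJ bL JT))).
apply/seteqP; split; first exact: ideal_bounded.
by move=> U bU; exact: (ideal_compl idJ (A := id)).
Qed.

End TriangularOperators.

(** * Towers *)

Section Towers.
Context (R : realType) (H : completeNormedModType R[i]).
Context (dot : {dot H for Num.conj}) (T : H -> H).
Hypothesis bT : bounded_op T.
Implicit Types (s : seq H) (u v h : H) (mu : R[i]).

(** For an orthonormal [s] this is membership in the span of [s]. *)
Definition expands s v : Prop := v = \sum_(g <- s) dot v g *: g.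

Lemma expands_linear s a u v :
  expands s u -> expands s v -> expands s (a *: u + v).
Proof.
rewrite /expands => {1}-> {1}->; rewrite scaler_sumr -big_split /=.
by apply: eq_bigr => g _; rewrite dotDl dotZl scalerDl scalerA.
Qed.

Lemma expands0 s : expands s 0.
Proof. by rewrite /expands big1// => g _; rewrite dot0l scale0r. Qed.

Lemma expandsD s u v : expands s u -> expands s v -> expands s (u + v).
Proof. by move=> su sv; rewrite -[u]scale1r; exact: expands_linear. Qed.

Lemma expandsZ s a u : expands s u -> expands s (a *: u).
Proof.
move=> su; rewrite -[X in expands _ X]addr0.
by apply: expands_linear (expands0 _).
Qed.

Lemma expandsB s u v : expands s u -> expands s v -> expands s (u - v).
Proof. by move=> su sv; rewrite -scaleN1r addrC; exact: expands_linear. Qed.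

Lemma expands_sum s r (F : H -> H) :
  (forall g, g \in r -> expands s (F g)) -> expands s (\sum_(g <- r) F g).
Proof.
move=> sF; rewrite big_seq; elim/big_ind: _ => //; first exact: expands0.
exact: expandsD.
Qed.

Lemma expands_dot0 s v h :
  (forall g, g \in s -> dot h g = 0) -> expands s v -> dot v h = 0.
Proof.
move=> sh ->; rewrite dot_suml big_seq big1// => g gs.
by rewrite dotZl (dotC dot g) sh// rmorph0 mulr0.
Qed.

(** An orthonormal list, most recent vector first, whose tails span invariant
    subspaces, [T] acting on each successive quotient line as a scalar of
    modulus at least [eps]. *)
Inductive tower (eps : R) : seq H -> Prop :=
| tower_nil : tower eps [::]
| tower_cons mu h s : tower eps s -> eps%:C <= `|mu| -> dot h h = 1 ->
    (forall g, g \in s -> dot h g = 0) -> expands s (T h - mu *: h) ->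
    tower eps (h :: s).

Lemma tower_inv eps h s : tower eps (h :: s) ->
  exists mu, [/\ tower eps s, eps%:C <= `|mu|, dot h h = 1,
    forall g, g \in s -> dot h g = 0 & expands s (T h - mu *: h)].
Proof.
move=> t; inversion t as [|mu h' s' ts mule hh hs Th]; exists mu.
by split.
Qed.

Section FixedTower.
Context (eps : R).

Lemma expands_cons h s v :
  tower eps (h :: s) -> expands s v -> expands (h :: s) v.
Proof.
move=> /tower_inv[mu [_ _ _ hs _]] sv.
by rewrite /expands big_cons (expands_dot0 hs)// scale0r add0r.
Qed.

Lemma expands_mem s g : tower eps s -> g \in s -> expands s g.
Proof.
elim: s => [//|h s IH] t; have [mu [ts _ hh hs _]] := tower_inv t.
rewrite in_cons => /predU1P[->|gs]; last exact: expands_cons (IH _ _).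
rewrite /expands big_cons hh scale1r big_seq big1 ?addr0// => g' g's.
by rewrite hs// scale0r.
Qed.

Lemma expands_comb s r (a : H -> R[i]) : tower eps s -> {subset r <= s} ->
  expands s (\sum_(g <- r) a g *: g).
Proof.
move=> ts rs; apply: expands_sum => g gr; apply: expandsZ.
by apply: expands_mem => //; exact: rs.
Qed.

Lemma tower_invariant s v : tower eps s -> expands s v -> expands s (T v).
Proof.
move=> ts ->; rewrite bounded_op_sum//; apply: expands_sum => g gs.
rewrite bounded_op_scale//; apply: expandsZ; move: gs.
elim: s ts => [//|h s IH] t; have [mu [ts _ hh hs Th]] := tower_inv t.
rewrite in_cons => /predU1P[->|gs]; last exact: expands_cons (IH _ _).
rewrite -(subrK (mu *: h) (T h)); apply: expandsD; first exact: expands_cons.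
by apply/expandsZ/expands_mem; rewrite ?mem_head.
Qed.

(** The Gram-Schmidt step: the new vector is the normalized component of [v]
    orthogonal to [s]; it inherits the condition on [mu - T] because the span of
    [s] is invariant. *)
Lemma tower_extend s v mu : tower eps s -> eps%:C <= `|mu| -> ~ expands s v ->
  expands s (mu *: v - T v) -> exists h, tower eps (h :: s).
Proof.
move=> ts mule nsv sTv.
pose p := \sum_(g <- s) dot v g *: g; pose w := v - p.
have sp : expands s p by exact: expands_comb.
have w0 : w != 0 by apply/eqP => /eqP; rewrite subr_eq0 => /eqP.
have ws g : g \in s -> dot w g = 0.
  move=> gs; apply/eqP; rewrite dotBl subr_eq0; apply/eqP.
  rewrite [in LHS](expands_mem ts gs) dot_sumr dot_suml; apply: eq_bigr => g' _.
  by rewrite dotZr dotZl mulrC (dotC dot g').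
pose a := (sqrtC (dot w w))^-1.
have ww : 0 < dot w w by rewrite dnorm_gt0.
have aR : a^*%R = a.
  by apply/CrealP; rewrite realV ger0_real// sqrtC_ge0 ltW.
exists (a *: w); apply: (@tower_cons _ mu) => //.
- by rewrite dotZl dotZr aR mulrA -expr2 /a exprVn sqrtCK mulVf ?gt_eqF.
- by move=> g gs; rewrite dotZl ws// mulr0.
- rewrite bounded_op_scale// scalerA mulrC -scalerA -scalerBr.
  have -> : T w - mu *: w = (mu *: p - T p) - (mu *: v - T v).
    rewrite /w bounded_op_sub// scalerBr !opprB addrC addrACA [RHS]addrACA.
    by congr (_ + _); exact: addrC.
  apply/expandsZ/expandsB => //; apply: expandsB; first exact: expandsZ.
  exact: tower_invariant.
Qed.

(** Otherwise the last vector outside the span of [s] among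
    [v, (mu - T) v, (mu - T)^2 v, ...] would prolong the tower. *)
Lemma generalized_eigenspace_expands s mu v :
  tower eps s -> (forall h, ~ tower eps (h :: s)) -> eps%:C <= `|mu| ->
  generalized_eigenspace T mu v -> expands s v.
Proof.
move=> ts smax mule [n]; elim: n v => [|n IH] v.
  by move=> /= ->; exact: expands0.
rewrite iterSr => /IH sTv; apply: contrapT => nsv.
by have [h /smax] := tower_extend ts mule nsv sTv.
Qed.

(** The matrix of [T] on a tower is triangular, so every eigenvalue occurs on its
    diagonal; [F] lists the diagonal. *)
Lemma tower_eigenvalues s : tower eps s -> exists F : seq R[i],
  forall mu v, v != 0 -> expands s v -> T v = mu *: v -> mu \in F.
Proof.
elim: s => [|h s IH] t.
  exists [::] => mu v /eqP v0 sv; exfalso; apply: v0.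
  by rewrite sv big_nil.
have [mu0 [ts _ hh hs Th]] := tower_inv t; have [F FP] := IH ts.
exists (mu0 :: F) => mu v v0 sv Tv.
pose v' := \sum_(g <- s) dot v g *: g.
have vE : v = dot v h *: h + v' by rewrite {1}sv big_cons.
have sv' : expands s v' by exact: expands_comb.
have [a0|a0] := eqVneq (dot v h) 0.
  rewrite in_cons (FP mu v v0 _ Tv) ?orbT//.
  by rewrite vE a0 scale0r add0r.
rewrite in_cons; suff -> : mu = mu0 by rewrite eqxx.
have : dot (T v) h = dot v h * mu0.
  rewrite vE bounded_op_add// bounded_op_scale// dotDl dotZl -vE.
  rewrite (expands_dot0 hs (tower_invariant ts sv')) addr0; congr (_ * _).
  rewrite -(subrK (mu0 *: h) (T h)) dotDl (expands_dot0 hs Th) add0r.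
  by rewrite dotZl hh mulr1.
by rewrite Tv dotZl mulrC => /(mulfI a0).
Qed.

(** Going from [s] to [h :: s] raises the dimension by one exactly when [W]
    contains a vector not orthogonal to [h]. *)
Lemma subspace_has_dim s (W : set H) : tower eps s -> W 0 ->
  (forall a u v, W u -> W v -> W (a *: u + v)) ->
  (forall v, W v -> expands s v) -> exists d, has_dim W d.
Proof.
move=> + W0; elim: s W W0 => [|h s IH] W W0 t WL Ws.
  exists 0%N, (fun=> 0); split=> [c _ []//|v]; split.
    by move=> /Ws ->; exists (fun=> 0); rewrite big_nil big_ord0.
  by move=> [c ->]; rewrite big_ord0.
have [mu0 [ts _ hh hs _]] := tower_inv t.
pose W' := [set v | W v /\ dot v h = 0].
have [d [b [bfree bspan]]] : exists d, has_dim W' d.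
  apply: IH => //; first by split; rewrite ?dot0l.
    move=> a u v [Wu uh] [Wv vh]; split; first exact: WL.
    by rewrite dotDl dotZl uh vh mulr0 addr0.
  by move=> v [/Ws + vh]; rewrite /expands big_cons vh scale0r add0r.
have [all0|] := pselect (forall v, W v -> dot v h = 0).
  exists d, b; split=> // v; rewrite -bspan; split=> [Wv|[]//].
  by split=> //; exact: all0.
move=> /existsNP[w /not_implyP[Ww /eqP wh]].
exists d.+1, (fun i => if unlift ord0 i is Some j then b j else w).
have sumE (c : 'I_d.+1 -> R[i]) :
    \sum_i c i *: (if unlift ord0 i is Some j then b j else w) =
    c ord0 *: w + \sum_i c (lift ord0 i) *: b i.
  rewrite big_ord_recl unlift_none; congr (_ + _).
  by apply: eq_bigr => i _; rewrite liftK.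
have bW' (c : 'I_d -> R[i]) : W' (\sum_i c i *: b i) by apply/bspan; exists c.
split=> [c|v].
  rewrite sumE => c0.
  have c00 : c ord0 = 0.
    have := congr1 (fun x => dot x h) c0.
    rewrite dotDl dotZl (bW' _).2 addr0 dot0l => /eqP.
    by rewrite mulf_eq0 (negbTE wh) orbF => /eqP.
  move: c0; rewrite c00 scale0r add0r => /bfree cb i.
  by case: (unliftP ord0 i) => [j ->|->].
split=> [Wv|[c ->]].
  pose a := dot v h / dot w h.
  have /bspan[c cE] : W' (v - a *: w).
    rewrite -scaleNr addrC; split; first exact: WL.
    by rewrite dotDl dotZl mulNr /a divfK// addNr.
  exists (fun i => if unlift ord0 i is Some j then c j else a).
  rewrite sumE unlift_none -[LHS](subrK (a *: w)) cE addrC; congr (_ + _).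
  by apply: eq_bigr => i _; rewrite liftK.
by rewrite sumE; apply: WL => //; exact: (bW' _).1.
Qed.

End FixedTower.
End Towers.

(** * Eigenvalues of members of a proper ideal *)

Section GeneralizedEigenspaces.
Context (R : realType) (H : completeNormedModType R[i]) (T : H -> H).
Hypothesis bT : bounded_op T.

Lemma generalized_eigenspace_linear mu a u v :
  generalized_eigenspace T mu u -> generalized_eigenspace T mu v ->
  generalized_eigenspace T mu (a *: u + v).
Proof.
pose F := fun w => mu *: w - T w.
have FL b x y : F (b *: x + y) = b *: F x + F y.
  rewrite /F (bounded_op_add _ _ bT) (bounded_op_scale _ _ bT) scalerDr scalerBr.
  by rewrite opprD addrACA !scalerA mulrC.
have iterL n b x y : iter n F (b *: x + y) = b *: iter n F x + iter n F y.
  by elim: n => [//|n IH]; rewrite !iterS IH FL.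
have F0 n : iter n F 0 = 0.
  elim: n => [//|n IH]; rewrite iterS IH /F scaler0.
  by rewrite (bounded_op_zero bT) subrr.
move=> [n un] [m vm]; exists (m + n)%N; rewrite -/F iterL.
rewrite iterD un F0 scaler0 add0r addnC iterD vm F0//.
Qed.

Lemma generalized_eigenspace_eigenvector mu v : v != 0 ->
  generalized_eigenspace T mu v -> exists2 w, w != 0 & T w = mu *: w.
Proof.
move=> v0 [n]; elim: n v v0 => [|n IH] v v0; first by move/eqP: v0.
rewrite iterSr => Fv.
have [/eqP Tv|/IH] := eqVneq (mu *: v - T v) 0; last exact.
by exists v => //; apply/esym/eqP; rewrite -subr_eq0.
Qed.

End GeneralizedEigenspaces.

Section ProperIdeal.
Context (R : realType) (H : completeNormedModType R[i]).
Context (dot : {dot H for Num.conj}) (e : nat -> H) (J : set (H -> H)).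
Context (T : H -> H).
Hypothesis hdot : dot_induces_norm dot.
Hypothesis be : orthonormal_basis dot e.
Hypothesis properJ : proper_two_sided_ideal J.
Hypothesis JT : J T.

Let idJ : two_sided_ideal J := properJ.1.
Let bT : bounded_op T := ideal_bounded idJ JT.

(** An infinite tower is an orthonormal sequence on which [T] is triangular with
    diagonal bounded away from zero, which no member of a proper ideal allows. *)
Lemma exists_maximal_tower (eps : R) : 0 < eps ->
  exists2 s, tower dot T eps s & forall h, ~ tower dot T eps (h :: s).
Proof.
move=> eps0; apply: contrapT => nomax; apply: properJ.2.
have [f fP] : exists f, forall n, tower dot T eps (history f n) ->
    tower dot T eps (history f n.+1).
  have [|f fP] := @history_choice _
    (fun s h => tower dot T eps s -> tower dot T eps (h :: s)).
    move=> s; apply: contrapT => /forallNP sP; apply: nomax; exists s.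
      by have /not_implyP[] := sP 0.
    by move=> h ht; apply: (sP h).
  by exists f => n; rewrite historyS; exact: fP.
have tf n : tower dot T eps (history f n).
  by elim: n => [|n /fP//]; exact: tower_nil.
have inv n : exists mu, [/\ tower dot T eps (history f n), eps%:C <= `|mu|,
    dot (f n) (f n) = 1, forall g, g \in history f n -> dot (f n) g = 0 &
    expands dot (history f n) (T (f n) - mu *: f n)].
  by apply: tower_inv; rewrite -historyS.
have perp n m : (n < m)%N -> dot (f m) (f n) = 0.
  by move=> nm; have [mu [_ _ _ hs _]] := inv m; exact/hs/mem_history.
apply: (ideal_full_of_triangular hdot be idJ JT (f := f) (eps := eps)) => //.
- move=> i j; have [<-|] := eqVneq i j; first by have [mu []] := inv i.
  rewrite neq_ltn => /orP[ij|/perp//].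
  by rewrite dotC perp// rmorph0.
- move=> n m nm; apply: (@expands_dot0 _ _ dot (history f n.+1)).
    move=> g; rewrite /history mem_rev => /mapP[k].
    rewrite mem_iota => /andP[_ kn] ->.
    by apply: perp; apply: leq_trans nm.
  apply: (tower_invariant bT (tf _)); apply: (expands_mem (tf _)).
  exact: mem_history.
- move=> n; have [mu [_ mule hh hs Te]] := inv n.
  rewrite -(subrK (mu *: f n) (T (f n))) dotDl (expands_dot0 hs Te) add0r.
  by rewrite dotZl hh mulr1.
Qed.

Lemma proper_ideal_finite_multiplicity mu : mu != 0 ->
  exists d, has_dim (generalized_eigenspace T mu) d.
Proof.
rewrite -normr_gt0 => /gt0_ReC[eps eps0 muE].
have [s ts smax] := exists_maximal_tower eps0.
apply: (subspace_has_dim ts); first by exists 0%N.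
  by move=> a u v; exact: (generalized_eigenspace_linear bT).
move=> v; apply: (generalized_eigenspace_expands bT ts smax).
by rewrite muE.
Qed.

Lemma proper_ideal_eigenvalues (eps : R) : 0 < eps ->
  exists F : seq R[i], forall mu v, eps%:C <= `|mu| -> v != 0 ->
    generalized_eigenspace T mu v -> mu \in F.
Proof.
move=> /exists_maximal_tower[s ts smax].
have [F FP] := tower_eigenvalues bT ts; exists F => mu v mule v0.
move=> /(generalized_eigenspace_eigenvector v0)[w w0 Tw].
apply: (FP mu w w0 _ Tw).
apply: (generalized_eigenspace_expands bT ts smax mule).
by exists 1%N; rewrite /= Tw subrr.
Qed.

End ProperIdeal.

(** * Listing eigenvalues by decreasing modulus *)

Section Enumeration.
Context (R : realType).
Implicit Types (s : seq R[i]) (mu : R[i]).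

Lemma exists_max_norm s : s != [::] ->
  exists2 m, m \in s & forall z, z \in s -> `|z| <= `|m|.
Proof.
elim: s => [//|x s IH] _; have [->|/IH[m ms hm]] := eqVneq s [::].
  by exists x; rewrite ?mem_head// => z; rewrite inE => /eqP->.
have [xm|mx] := real_leP (normr_real x) (normr_real m).
  exists m; first by rewrite in_cons ms orbT.
  by move=> z; rewrite in_cons => /predU1P[->//|/hm].
exists x; first exact: mem_head.
move=> z; rewrite in_cons => /predU1P[->//|/hm zm].
exact: le_trans zm (ltW mx).
Qed.

Lemma leq_size_sum_count (X : eqType) (s F : seq X) : {subset s <= F} ->
  (size s <= \sum_(x <- F) count_mem x s)%N.
Proof.
elim: s => [//|y s IH] sF /=; rewrite big_split /= -add1n leq_add//.
  by rewrite (big_rem y) ?sF ?mem_head//= eqxx.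
by apply: IH => z zs; apply: sF; rewrite in_cons zs orbT.
Qed.

(** The next term has the largest modulus among the [mu] that occur less than
    [dim mu] times so far, and is [0] if there is none. Nothing is left out: a
    [mu] never exhausted would bound the moduli of all terms from below, while
    there are finitely many candidates of modulus at least that of [mu], each of
    which is used at most [dim] times. *)
Lemma multiplicity_sequence (dim : R[i] -> nat) : dim 0 = 0%N ->
  (forall eps : R, 0 < eps -> exists F : seq R[i],
    forall mu, eps%:C <= `|mu| -> (0 < dim mu)%N -> mu \in F) ->
  exists x : nat -> R[i], (forall n, `|x n.+1| <= `|x n|) /\
    forall mu, mu != 0 -> ([set n | x n = mu] #= `I_(dim mu))%card.
Proof.
move=> dim0 dimF.
pose avail s mu := (count_mem mu s < dim mu)%N.
have avail_neq0 s mu : avail s mu -> mu != 0.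
  by apply: contraTneq => ->; rewrite /avail dim0.
have availF s mu : avail s mu -> exists F : seq R[i],
    forall s' nu, avail s' nu -> `|mu| <= `|nu| -> nu \in F.
  move=> /avail_neq0; rewrite -normr_gt0 => /gt0_ReC[eps /dimF[F FP] muE].
  exists F => s' nu av mnu; apply: FP; first by rewrite -muE.
  exact: leq_ltn_trans av.
pose next s z := (avail s z \/ z = 0) /\ forall mu, avail s mu -> `|mu| <= `|z|.
have [x xP] : exists x, forall n, next (history x n) (x n).
  apply: history_choice => s.
  have [[mu av]|noav] := pselect (exists mu, avail s mu); last first.
    exists 0; split; first by right.
    by move=> mu av; exfalso; apply: noav; exists mu.
  have [F FP] := availF _ _ av.
  pose C := [seq z <- F | avail s z].
  have mem_C nu : avail s nu -> `|mu| <= `|nu| -> nu \in C.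
    by move=> avn mn; rewrite mem_filter avn (FP s).
  have [|m mC hm] := @exists_max_norm C.
    by apply/eqP => C0; have := mem_C mu av (lexx _); rewrite C0.
  exists m; split; first by left; move: mC; rewrite mem_filter => /andP[].
  move=> nu avn.
  have [mn|/ltW nm] := real_leP (normr_real mu) (normr_real nu).
    exact/hm/mem_C.
  exact: le_trans nm (hm _ (mem_C _ av (lexx _))).
have count_le mu n : mu != 0 -> (count_mem mu (history x n) <= dim mu)%N.
  move=> mu0; elim: n => [//|n IH]; rewrite historyS /=.
  have [xn|_] := eqVneq (x n) mu; last by rewrite add0n.
  have [[av|x0] _] := xP n; first by move: av; rewrite xn.
  by move: mu0; rewrite -xn x0 eqxx.
exists x; split=> [n|mu mu0].
  have [[av|->] _] := xP n.+1; last by rewrite normr0.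
  apply: (xP n).2; move: av; rewrite /avail historyS /= => av.
  exact: leq_ltn_trans (leq_addl _ _) av.
have [N cN] : exists N, count_mem mu (history x N) = dim mu.
  apply: contrapT => noN.
  have av n : avail (history x n) mu.
    rewrite /avail ltn_neqAle count_le// andbT; apply/eqP => c.
    by apply: noN; exists n.
  have [F FP] := availF _ _ (av 0%N).
  have mx n : `|mu| <= `|x n| := (xP n).2 mu (av n).
  have x0 n : x n != 0.
    by rewrite -normr_gt0; apply: lt_le_trans (mx n); rewrite normr_gt0.
  pose F' := [seq z <- F | z != 0].
  have xF n : x n \in F'.
    rewrite mem_filter x0 /=; have [[avx|xn0] _] := xP n.
      exact: FP avx (mx n).
    by have := x0 n; rewrite xn0 eqxx.
  pose n := (\sum_(z <- F') dim z).+1.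
  have : (size (history x n) <= \sum_(z <- F') count_mem z (history x n))%N.
    apply: leq_size_sum_count => z; rewrite mem_rev => /mapP[k _ ->].
    exact: xF.
  rewrite size_history leqNgt ltnS => /negP; apply.
  rewrite big_seq [leqRHS]big_seq; apply: leq_sum => z.
  by rewrite mem_filter => /andP[z0 _]; exact: count_le.
have notN n : (N <= n)%N -> x n != mu.
  move=> Nn; apply/eqP => xn.
  have : (count_mem mu (history x N) < count_mem mu (history x n.+1))%N.
    rewrite historyS /= xn eqxx add1n ltnS -(subnKC Nn).
    elim: (n - N)%N => [|k IH]; first by rewrite addn0.
    by rewrite addnS historyS /= (leq_trans IH)// leq_addl.
  by rewrite cN ltnNge count_le.
have -> : [set n | x n = mu] =
    [set` [fset n in [seq n <- iota 0 N | x n == mu]]%fset].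
  apply/seteqP; split=> n /=; rewrite !inE mem_filter mem_iota /= add0n.
    move=> xn; rewrite xn eqxx ltnNge; apply/negP => /notN.
    by rewrite xn eqxx.
  by move=> /andP[/eqP].
apply/card_eq_fsetP; rewrite card_fseq undup_id ?filter_uniq ?iota_uniq//.
by rewrite -cN size_filter /history count_rev count_map.
Qed.

End Enumeration.

(** * Exchanging the factors of a product *)

Section EigenvalueSequences.
Context (R : realType) (H : completeNormedModType R[i]).

Lemma generalized_eigenspace_intertwine (A B : H -> H) mu v :
  bounded_op B -> generalized_eigenspace (A \o B) mu v ->
  generalized_eigenspace (B \o A) mu (B v).
Proof.
move=> bB [n vn]; exists n; rewrite -[RHS](bounded_op_zero bB) -vn.
elim: n v {vn} => [//|n IH] v; rewrite !iterSr -IH; congr iter.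
by rewrite bounded_op_sub// bounded_op_scale.
Qed.

(** By induction on the power of [mu - B A] annihilating [w]: the vector
    [mu *: w - B (A w)] is annihilated by a lower power, so it is some [B v'], and
    [mu *: w] is the image under [B] of [A w + v']. *)
Lemma generalized_eigenspace_preimage (A B : H -> H) mu w :
  bounded_op A -> bounded_op B -> mu != 0 ->
  generalized_eigenspace (B \o A) mu w ->
  exists2 v, generalized_eigenspace (A \o B) mu v & w = B v.
Proof.
move=> bA bB mu0 [n]; elim: n w => [|n IH] w.
  by move=> /= ->; exists 0; [exists 0%N|rewrite bounded_op_zero].
move=> wn; have := wn; rewrite iterSr => /IH[v' GEv' v'E].
have GEw : generalized_eigenspace (A \o B) mu (A w).
  by apply: generalized_eigenspace_intertwine => //; exists n.+1.
exists (mu^-1 *: (A w + v')).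
  have bAB := bounded_op_comp bA bB.
  rewrite -[X in generalized_eigenspace _ _ X]addr0.
  apply: (generalized_eigenspace_linear bAB) => //; last by exists 0%N.
  by rewrite -[A w]scale1r; exact: (generalized_eigenspace_linear bAB).
rewrite bounded_op_scale// bounded_op_add// -v'E /= addrC subrK.
by rewrite scalerA mulVf// scale1r.
Qed.

(** If [B v = 0], then [mu - A B] multiplies [v] by [mu]. *)
Lemma generalized_eigenspace_kernel (A B : H -> H) mu v :
  bounded_op A -> bounded_op B -> mu != 0 ->
  generalized_eigenspace (A \o B) mu v -> B v = 0 -> v = 0.
Proof.
move=> bA bB mu0 [n] + Bv; have -> : iter n (fun w => mu *: w - (A \o B) w) v =
    mu ^+ n *: v.
  elim: n => [|n IH]; first by rewrite expr0 scale1r.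
  rewrite iterS IH /= (bounded_op_scale _ _ bB) Bv scaler0 (bounded_op_zero bA) subr0.
  by rewrite scalerA -exprS.
by move/eqP; rewrite scaler_eq0 expf_eq0 (negbTE mu0) andbF => /eqP.
Qed.

Lemma has_dim_generalized_eigenspace_comp (A B : H -> H) mu d :
  bounded_op A -> bounded_op B -> mu != 0 ->
  has_dim (generalized_eigenspace (A \o B) mu) d ->
  has_dim (generalized_eigenspace (B \o A) mu) d.
Proof.
move=> bA bB mu0 [b [bfree bspan]]; exists (B \o b).
have sumB (c : 'I_d -> R[i]) :
    \sum_i c i *: (B \o b) i = B (\sum_i c i *: b i).
  by rewrite bounded_op_sum//; apply: eq_bigr => i _; rewrite bounded_op_scale.
split=> [c|w].
  rewrite sumB => Bc; apply: bfree.
  by apply: (generalized_eigenspace_kernel bA bB mu0) Bc; apply/bspan; exists c.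
split=> [|[c ->]].
  move=> /(generalized_eigenspace_preimage bA bB mu0)[v GEv ->].
  by have [c ->] := (bspan v).1 GEv; exists c; rewrite sumB.
rewrite sumB; apply: generalized_eigenspace_intertwine => //.
by apply/bspan; exists c.
Qed.

Lemma eigenvalue_sequence_comp (A B : H -> H) x :
  bounded_op A -> bounded_op B ->
  eigenvalue_sequence (A \o B) x -> eigenvalue_sequence (B \o A) x.
Proof.
move=> bA bB [xle xdim]; split=> // mu mu0; have [d [dimd cardd]] := xdim mu mu0.
by exists d; split=> //; exact: has_dim_generalized_eigenspace_comp.
Qed.

Lemma has_dim_neq0 (V : set H) d : has_dim V d -> (0 < d)%N ->
  exists2 v, v != 0 & V v.
Proof.
case: d => [//|d] [b [bfree bspan]] _.
have sumE : \sum_i (i == ord0)%:R *: b i = b ord0.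
  rewrite big_ord_recl /= scale1r big1 ?addr0// => i _.
  by rewrite scale0r.
exists (b ord0); last by apply/bspan; exists (fun i => (i == ord0)%:R); rewrite sumE.
apply/eqP => b0; have /eqP := bfree (fun i => (i == ord0)%:R) (etrans sumE b0) ord0.
by rewrite oner_eq0.
Qed.

Lemma exists_eigenvalue_sequence (dot : {dot H for Num.conj}) (e : nat -> H)
    (J : set (H -> H)) (T : H -> H) :
  dot_induces_norm dot -> orthonormal_basis dot e ->
  proper_two_sided_ideal J -> J T -> exists x, eigenvalue_sequence T x.
Proof.
move=> hdot be properJ JT.
have /choice[dim dimP] : forall mu, exists d,
    (mu != 0 -> has_dim (generalized_eigenspace T mu) d) /\ (mu = 0 -> d = 0%N).
  move=> mu; have [->|mu0] := eqVneq mu 0; first by exists 0%N.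
  have [d dP] := proper_ideal_finite_multiplicity hdot be properJ JT mu0.
  by exists d; split=> // /eqP; rewrite (negbTE mu0).
have [||x [xle xcard]] := @multiplicity_sequence R dim.
- exact: (dimP 0).2.
- move=> eps /(proper_ideal_eigenvalues hdot be properJ JT)[F FP].
  exists F => mu mule dim_gt0.
  have mu0 : mu != 0.
    by apply: contraTneq dim_gt0 => /(dimP mu).2 ->.
  have [v v0 GEv] := has_dim_neq0 ((dimP mu).1 mu0) dim_gt0.
  exact: FP mule v0 GEv.
exists x; split=> // mu mu0; exists (dim mu); split; last exact: xcard.
exact: (dimP mu).1.
Qed.

End EigenvalueSequences.

Theorem mainTheorem1 (R : realType) (H : completeNormedModType R[i])
    (dot : {dot H for Num.conj}) (e : nat -> H)
    (J : set (H -> H)) (tau : (H -> H) -> R[i]) :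
  dot_induces_norm dot ->
  separable_space H ->
  infinite_dimensional H ->
  orthonormal_basis dot e ->
  proper_two_sided_ideal J ->
  spectral_trace dot e J tau ->
  forall A B : H -> H, bounded_op A -> bounded_op B ->
    J (A \o B) -> J (B \o A) ->
    tau (A \o B) = tau (B \o A).
Proof.
move=> hdot _ _ be properJ [_ tau_spectral] A B bA bB JAB JBA.
have [x xAB] := exists_eigenvalue_sequence hdot be properJ JAB.
have xBA := eigenvalue_sequence_comp bA bB xAB.
by rewrite (tau_spectral _ JAB x xAB).2 (tau_spectral _ JBA x xBA).2.
Qed.
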